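(* Let $\gamma\in(0,2\beta_V)$ and $\alpha:=\frac{2\beta_V}{4\beta_V-\gamma}$. For all $k\ge0$, let $\lambda_k\in(0,1/\alpha)$, and suppose that $\underline\tau:=\inf_{j\ge0}(1-\alpha\lambda_j)\lambda_j/\alpha>0$. Let $z^0\in\mathcal H$, let $(z^j)_{j\ge0}$ be generated by the FDRS iteration $z^{k+1}=T_{\lambda_k}(z^k)$, let $z^*$ be a fixed point of $T$, let $x^*:=P_Vz^*$, and let $\widetilde\nabla f(x^* )\in\partial f(x^* )$ be such that $-\widetilde\nabla f(x^* )-\nabla h(x^* )\in V^\perp$. Then for all $k\ge0$, $$\|x_f^k-x_h^k\|\le\frac{\|z^0-z^*\|}{\sqrt{\underline\tau(k+1)}},\qquad \|x_f^k-x_h^k\|=o\left(\frac1{\sqrt{k+1}}\right),$$ and $$-\frac{\|z^0-z^*\|\,\|\widetilde\nabla f(x^* )\|}{\sqrt{\underline\tau(k+1)}}\le f(x_f^k)+h(x_h^k)-f(x^* )-g(x^* )\le\frac{\left(\|z^*-x^*\|+(1+\gamma/\beta_V)\|z^0-z^*\|+\gamma\|\nabla h(x^* )\|\right)\|z^0-z^*\|}{\gamma\sqrt{\underline\tau(k+1)}},$$ and $|f(x_f^k)+h(x_h^k)-f(x^* )-g(x^* )|=o(1/\sqrt{k+1})$ as $k\to\infty$.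
   Context: $\mathcal H$ is a real Hilbert space with identity map $I$; $V\subseteq\mathcal H$ is a closed vector subspace; $P_V,P_{V^\perp}$ are the orthogonal projections onto $V$ and $V^\perp$; $\chi_V$ is the indicator function of $V$ ($0$ on $V$, $+\infty$ elsewhere), so $\partial\chi_V(x)=V^\perp$ for $x\in V$ and $\emptyset$ otherwise. Standing assumptions: $f,g:\mathcal H\to(-\infty,\infty]$ are closed, proper and convex; $g$ is differentiable on $\mathcal H$ and $\nabla g$ is $(1/\beta)$-Lipschitz, $\beta>0$; $h:=g\circ P_V$, so $\nabla h=P_V\circ\nabla g\circ P_V$, and $\beta_V>0$ is such that $\nabla h$ is $(1/\beta_V)$-Lipschitz; there exists $x$ with $0\in\partial f(x)+\nabla g(x)+\partial\chi_V(x)$. For $\gamma>0$: $\mathrm{prox}_{\gamma f}(x):=\arg\min_{y}\left(f(y)+\frac1{2\gamma}\|y-x\|^2\right)$, $\mathrm{refl}_{\gamma f}:=2\,\mathrm{prox}_{\gamma f}-I$, $\mathrm{refl}_{\chi_V}:=2P_V-I$. The FDRS operator is $T:=\left(\frac12I+\frac12\mathrm{refl}_{\gamma f}\circ\mathrm{refl}_{\chi_V}\right)\circ(I-\gamma\nabla h)$, and $T_\lambda:=(1-\lambda)I+\lambda T$. The FDRS iteration from $z^0\in\mathcal H$ with relaxation parameters $(\lambda_j)_{j\ge0}$ is $z^{k+1}=T_{\lambda_k}(z^k)$, $k\ge0$. For each $k$: $x_h^k:=P_Vz^k$ and $x_f^k:=\mathrm{prox}_{\gamma f}\big(\mathrm{refl}_{\chi_V}(z^k-\gamma\nabla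 h(z^k))\big)$. *)

(* Defs.v *)
From HB Require Import structures.
From mathcomp Require Import all_boot all_order all_algebra.
From mathcomp Require Import all_classical all_reals all_analysis.
Set Implicit Arguments.
Unset Strict Implicit.
Unset Printing Implicit Defensive.
Import Order.TTheory GRing.Theory Num.Theory.
Import numFieldNormedType.Exports.
Local Open Scope classical_set_scope.
Local Open Scope ring_scope.

(* A real Hilbert space is given by a complete normed module [H] over a
   [realType], together with a dot product [ip : {dot H for idfun}] such that
   [`|x| = Num.sqrt (ip x x)]. *)

Section operators.
Context {R : realType} {H : completeNormedModType R}.

Definition refl (J : H -> H) (x : H) : H := 2 *: J x - x.

Definition relax (lambda : R) (T : H -> H) (x : H) : H :=
  (1 - lambda) *: x + lambda *: T x.

End operators.

Section convex_analysis.
Context {R : realType} {H : completeNormedModType R}.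
Implicit Types (f : H -> \bar R) (V : set H).

Definition eproper f := (forall x, f x != -oo%E) /\ (exists x, f x != +oo%E).

(* For a proper function no [+oo - oo] occurs; the endpoints are harmless since
   [0 * +oo = 0] in [\bar R]. *)
Definition econvex f := forall (t : R) (x y : H), 0 <= t <= 1 ->
  (f (t *: x + (1 - t) *: y)%R <= t%:E * f x + (1 - t)%R%:E * f y)%E.

Definition closed_proper_convex f :=
  [/\ lower_semicontinuous f, eproper f & econvex f].

(* Frechet differentiability of an extended-valued function at an interior
   point of its domain *)
Definition edifferentiable f (x : H) :=
  (\forall y \near x, f y \is a fin_num) /\
  differentiable (fine \o f : H -> R^o) x.

Definition indic_fun V (x : H) : \bar R := if x \in V then 0%E else +oo%E.

Definition closed_subspace V := closed V /\ submod_closed (mem V).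

Definition argmin f : set H := [set p | forall y, (f p <= f y)%E].

Definition prox (gamma : R) f (x : H) : H :=
  get (argmin (fun y => (f y + ((2 * gamma)^-1 * `|y - x| ^+ 2)%:E)%E)).

End convex_analysis.

Section hilbert.
Context {R : realType} {H : completeNormedModType R} (ip : {dot H for idfun}).
Implicit Types (f g : H -> \bar R) (V : set H).

Definition orthocomp V : set H := [set u | forall v, V v -> ip u v = 0].

Definition orthoproj V (x : H) : H := get [set p | V p /\ orthocomp V (x - p)].

Definition subdiff f (x : H) : set H :=
  [set u | forall y, (f x + (ip u (y - x))%:E <= f y)%E].

(* Riesz representative of the differential *)
Definition gradient f (x : H) : H :=
  get [set u | forall v, 'd (fine \o f : H -> R^o) x v = ip u v].

Definition fdrs (gamma : R) f g V : H -> H :=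
  (fun y => 2^-1 *: y + 2^-1 *: (refl (prox gamma f) \o refl (orthoproj V)) y)
  \o (fun z => z - gamma *: gradient (g \o orthoproj V) z).

End hilbert.

(* Main.v *)
Require Import Defs.
From HB Require Import structures.
From mathcomp Require Import all_boot all_order all_algebra.
From mathcomp Require Import all_classical all_reals all_analysis.
From mathcomp Require Import ring lra.
Set Implicit Arguments.
Unset Strict Implicit.
Unset Printing Implicit Defensive.
Import Order.TTheory GRing.Theory Num.Theory.
Import numFieldNormedType.Exports.
Local Open Scope classical_set_scope.
Local Open Scope ring_scope.

(** Write [G] for the gradient of [h = g \o P], [P] the projection onto [V].
    Since [G] is the projection of [gradient ip g \o P] onto [V], unfolding the
    operator gives [T z - z = x_f - x_h] ([fdrs_residual]): the quantity to be
    estimated is the fixed-point residual of [T].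

    The map that averages the identity and the composition of the two reflections
    is firmly nonexpansive, because subgradients of [f] are monotone, and [G] is
    [betaV]-cocoercive ([baillon_haddad]). Composing the two yields
      [|T x - T y|^2 <= |x - y|^2 - c |(x - T x) - (y - T y)|^2]
    with [c = 1 - gamma / (2 betaV)], and [1 + c = alpha^-1]
    ([averaged_comp]). For the relaxed iteration this has two consequences: the
    squared distance to a fixed point decreases at each step by at least
    [tau |T z - z|^2] ([fejer]), and the residual [|T z - z|] never increases
    ([residual_nonincreasing]). A nonincreasing sequence whose squares are
    summable is bounded by the claimed rate ([fejer_rate]) and is even
    [o(1 / sqrt (k + 1))] ([summable_littleo]).

    The objective gap is squeezed between multiples of the residual. The
    subgradient inequalities of [f] and [h] at [xs] bound it from below, the
    gradient terms cancelling up to [x_f - x_h] because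
    [- gradf - G xs] is orthogonal to [V] ([gap_lower_bound]). The same
    inequalities at [x_f] and [x_h] bound it from above, the subgradient of [f]
    at [x_f] being the one that the proximal step produces ([gap_upper_bound]).

    All of this needs the operators to be what their names say, although they
    are defined by choosing an element of a possibly empty set. The three
    existence results involved are instances of a single one: a closed convex
    function that decreases at most linearly in the norm, plus a positive
    multiple of a squared distance, attains its minimum ([argmin_regularized_ex]). Applied to [f] it
    gives the proximal point, applied to the indicator of [V] it gives the
    orthogonal projection, and applied to the opposite of a continuous linear
    form it gives the Riesz representative, hence the gradient. *)

(** * Inner product *)

Section inner_product.
Context {R : realType} {H : completeNormedModType R} (ip : {dot H for idfun}).

Lemma ipC x y : ip x y = ip y x.
Proof. by have := hermC ip x y; rewrite expr0 mul1r. Qed.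

Lemma ipDl x y u : ip (x + y) u = ip x u + ip y u.
Proof. by rewrite linearDl. Qed.
Lemma ipNl x u : ip (- x) u = - ip x u.
Proof. by rewrite linearNl. Qed.
Lemma ipZl a x u : ip (a *: x) u = a * ip x u.
Proof. by rewrite linearZl_LR. Qed.
Lemma ip0l u : ip 0 u = 0.
Proof. by rewrite linear0l. Qed.
Lemma ipDr u x y : ip u (x + y) = ip u x + ip u y.
Proof. by rewrite linearDr. Qed.
Lemma ipNr u x : ip u (- x) = - ip u x.
Proof. by rewrite linearNr. Qed.
Lemma ipZr a u x : ip u (a *: x) = a * ip u x.
Proof. by rewrite ipC ipZl ipC. Qed.
Lemma ip0r u : ip u 0 = 0.
Proof. by rewrite linear0r. Qed.

Definition ipE := (ipDl, ipNl, ipZl, ipDr, ipNr, ipZr).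

Context (ip_norm : forall x : H, `|x| = Num.sqrt (ip x x)).

Lemma ip_ge0 x : 0 <= ip x x.
Proof.
have [->|x0] := eqVneq x 0; first by rewrite ip0l.
exact/ltW/(neq0_dnorm_gt0 _ x0).
Qed.

Lemma ipxx x : ip x x = `|x| ^+ 2.
Proof. by rewrite ip_norm sqr_sqrtr // ip_ge0. Qed.

Lemma ip_eq0 x : (forall v, ip x v = 0) -> x = 0.
Proof.
by move=> /(_ x); rewrite ipxx => /eqP; rewrite sqrf_eq0 normr_eq0 => /eqP.
Qed.

(** Turns a linear identity between vectors into one between scalars, which
    decision procedures for ordered fields can prove. *)
Lemma ip_inj x y : (forall v, ip x v = ip y v) -> x = y.
Proof.
move=> xy; apply/eqP; rewrite -subr_eq0; apply/eqP/ip_eq0 => v.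
by rewrite ipDl ipNl xy subrr.
Qed.

Lemma cauchy_schwarz x y : `|ip x y| <= `|x| * `|y|.
Proof.
have [->|y0] := eqVneq y 0; first by rewrite ip0r normr0 normr0 mulr0.
have yy : 0 < `|y| ^+ 2 by rewrite exprn_gt0 // normr_gt0.
rewrite -(@ler_pXn2r _ 2) ?nnegrE ?mulr_ge0 // exprMn real_normK ?num_real //.
(* this vector is [|y|^2] times the component of [x] orthogonal to [y] *)
have := ip_ge0 (`|y| ^+ 2 *: x - ip x y *: y).
rewrite !ipE !ipxx (ipC y x); set c := ip x y => h.
rewrite -(ler_pM2l yy); lra.
Qed.

Lemma ip_le x y : ip x y <= `|x| * `|y|.
Proof. exact: le_trans (ler_norm _) (cauchy_schwarz x y). Qed.

Lemma ip_ge x y : - (`|x| * `|y|) <= ip x y.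
Proof. by have := cauchy_schwarz x y; rewrite ler_norml => /andP[]. Qed.

End inner_product.

(** * Minimizing a convex function plus a squared distance *)

Section regularized_minimization.
Context {R : realType} {H : completeNormedModType R} (ip : {dot H for idfun}).
Context (ip_norm : forall x : H, `|x| = Num.sqrt (ip x x)).
Implicit Types (f : H -> \bar R) (p x y : H) (q r s : R).

Lemma econvex_le f t x y r s : econvex f -> 0 <= t <= 1 ->
  (f x <= r%:E)%E -> (f y <= s%:E)%E ->
  (f (t *: x + (1 - t) *: y)%R <= (t * r + (1 - t) * s)%:E)%E.
Proof.
move=> cf /andP[t0 t1] fx fy; apply: (le_trans (cf _ _ _ _)).
  by rewrite t0 t1.
rewrite [leRHS]EFinD !EFinM; apply: leeD; apply: lee_wpmul2l => //.
by rewrite lee_fin subr_ge0.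
Qed.

(** The quadratic term dominates the minorant, so the infimum is finite, and it
    makes the sum strongly convex, so every minimizing sequence is Cauchy. Its
    limit is a minimizer by lower semicontinuity. The minorant is a function
    of the norm and not a linear form, so that the lemma also serves to
    prove the Riesz representation theorem, before any linear form is known to
    be an inner product. *)
Lemma argmin_regularized_ex f q x : 0 < q ->
  lower_semicontinuous f -> eproper f -> econvex f ->
  (exists a b, forall y, ((a - b * `|y|)%:E <= f y)%E) ->
  exists p, argmin (fun y => (f y + (q * `|y - x| ^+ 2)%:E)%E) p.
Proof.
move=> q0 lf [fN [x0 fx0]] cf [a [b fab]].
pose F y := (f y + (q * `|y - x| ^+ 2)%:E)%E.
pose A := [set r : R | exists y, (F y <= r%:E)%E].
have FE y r : (F y <= r%:E)%E = (f y <= (r - q * `|y - x| ^+ 2)%:E)%E.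
  by rewrite /F EFinB leeBrDr.
have fE y : f y != +oo%E -> f y = (fine (f y))%:E.
  by move=> fy; rewrite fineK // fin_numE fN fy.
have A0 : A !=set0.
  exists (fine (f x0) + q * `|x0 - x| ^+ 2), x0.
  by rewrite FE addrK -fE.
have Alb : has_lbound A.
  exists (a - b * `|x| - b ^+ 2 / (4 * q) - 2 * `|b| * `|x|) => r [y].
  rewrite FE => /(le_trans (fab y)); rewrite lee_fin => hr.
  suff: b * `|y| - q * `|y - x| ^+ 2 <=
      b * `|x| + b ^+ 2 / (4 * q) + 2 * `|b| * `|x| by lra.
  have qE : b ^+ 2 / (4 * q) * (4 * q) = b ^+ 2 by rewrite divfK; lra.
  have d0 : 0 <= `|y - x| by [].
  (* completing the square in [|y - x|] *)
  have h1 : `|b| * `|y - x| - q * `|y - x| ^+ 2 <= b ^+ 2 / (4 * q).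
    rewrite -(@ler_pM2r _ (4 * q)) ?qE -?[b ^+ 2]real_normK ?num_real //; last lra.
    by have := sqr_ge0 (`|b| - 2 * q * `|y - x|); lra.
  have h2 : b * (`|y| - `|x|) <= `|b| * `|y - x|.
    apply: (le_trans (ler_norm _)); rewrite normrM ler_wpM2l //.
    exact: ler_dist_dist.
  have : 0 <= `|b| * `|x| by rewrite mulr_ge0.
  by lra.
have hinf : has_inf A by [].
pose m := inf A.
have mA r : A r -> m <= r by move=> /(ge_inf Alb).
have /choice[u uP] : forall n : nat, exists y, (F y <= (m + n.+1%:R^-1)%:E)%E.
  move=> n; have n0 : 0 < n.+1%:R^-1 :> R by rewrite invr_gt0.
  have [r [y Fy] rm] := inf_adherent n0 hinf.
  by exists y; apply: (le_trans Fy); rewrite lee_fin ltW.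
(* by the parallelogram law, two points that nearly minimize are close *)
have close y y' r s : (F y <= r%:E)%E -> (F y' <= s%:E)%E ->
    q * `|y - y'| ^+ 2 <= 2 * (r - m + (s - m)).
  rewrite !FE => hy hy'.
  have h2 : 0 <= (2^-1 : R) <= 1 by apply/andP; split; lra.
  have := econvex_le cf h2 hy hy'; set w := (X in f X).
  move=> hw.
  have wE : `|w - x| ^+ 2 = 2^-1 * `|y - x| ^+ 2 + 2^-1 * `|y' - x| ^+ 2
      - 4^-1 * `|y - y'| ^+ 2.
    rewrite -!(ipxx ip_norm) /w !ipE (ipC ip y' y) (ipC ip x y) (ipC ip x y').
    by field.
  have : A ((r + s) / 2 - q * (4^-1 * `|y - y'| ^+ 2)).
    exists w; rewrite FE; apply: (le_trans hw).
    by rewrite lee_fin wE; lra.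
  by move=> /mA; lra.
have nearly (e : R) : 0 < e -> \forall n \near \oo, (n.+1%:R^-1 < e).
  by move=> e0; near=> n; near: n; exact: near_infty_natSinv_lt (PosNum e0).
have cu : cauchy (u n @[n --> \oo]).
  apply: cauchy_exP => e e0.
  have e4 : 0 < q * e ^+ 2 / 4 by rewrite divr_gt0 ?mulr_gt0 ?exprn_gt0.
  have [N _ Ne] := nearly _ e4.
  exists (u N); exists N => // n /= Nn.
  rewrite -ball_normE /= -(@ltr_pXn2r _ 2) ?nnegrE ?(ltW e0) //.
  rewrite -(ltr_pM2l q0).
  have := close _ _ _ _ (uP N) (uP n).
  have /= := Ne N (leqnn N); have /= := Ne n Nn.
  by set a1 := n.+1%:R^-1; set a2 := N.+1%:R^-1; lra.
have /cauchy_cvgP/cvg_ex[p up] := cu.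
have Fp : (F p <= m%:E)%E.
  rewrite FE leNgt; apply/negP => fp.
  have [e e0 fpe] : exists2 e, 0 < e & ((m - q * `|p - x| ^+ 2 + e)%:E < f p)%E.
    have [fpy|fpy] := eqVneq (f p) +oo%E.
      by exists 1 => //; rewrite fpy ltry.
    move: fp; rewrite (fE _ fpy) lte_fin => fp.
    exists ((fine (f p) - (m - q * `|p - x| ^+ 2)) / 2); first lra.
    by rewrite lte_fin; lra.
  have [W Wp Wf] := lf _ _ fpe.
  have cvd : q * `|u n - x| ^+ 2 @[n --> \oo] --> q * `|p - x| ^+ 2.
    apply: cvgMr; rewrite expr2; under eq_fun do rewrite expr2.
    have : `|u n - x| @[n --> \oo] --> `|p - x|.
      by apply: cvg_norm; apply: cvgB => //; exact: cvg_cst.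
    by move=> h; apply: cvgM.
  have : \forall n \near \oo, False.
    have e2 : 0 < e / 2 by lra.
    have near1 := nearly _ e2.
    have near2 := up _ Wp.
    have /cvgrPdist_lt/(_ _ e2) near3 := cvd.
    near=> n.
    have n1 : n.+1%:R^-1 < e / 2 by near: n.
    have n2 : W (u n) by near: n.
    have : `|q * `|p - x| ^+ 2 - q * `|u n - x| ^+ 2| < e / 2 by near: n.
    rewrite ltr_norml => /andP[_ n3].
    have := uP n; rewrite FE => /(lt_le_trans (Wf _ n2)).
    rewrite lte_fin => n4; suff : e < e by rewrite ltxx.
    by move: (n.+1%:R^-1) n1 n3 n4 => *; lra.
  by case=> N _ /(_ N) => h; apply: h => /=.
exists p => y; apply: (le_trans Fp).
have [fy|fy] := eqVneq (f y) +oo%E; first by rewrite fy leey.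
rewrite (fE _ fy) lee_fin; apply: mA; exists y.
by rewrite FE addrK -fE.
Unshelve. all: by end_near. Qed.

(** First-order optimality, the quadratic term having gradient
    [2 * q *: (p - x)] at [p]. *)
Lemma argmin_regularized_subdiff f q x p : 0 < q ->
  eproper f -> econvex f ->
  argmin (fun y => (f y + (q * `|y - x| ^+ 2)%:E)%E) p ->
  f p \is a fin_num /\ subdiff ip f p ((2 * q) *: (x - p)).
Proof.
move=> q0 [fN [x0 fx0]] cf pmin.
have fE y : f y != +oo%E -> f y = (fine (f y))%:E.
  by move=> fy; rewrite fineK // fin_numE fN fy.
have fpy : f p != +oo%E.
  by apply/eqP => fp; have := pmin x0; rewrite fp (fE _ fx0).
split; first by rewrite fin_numE fN.
move=> y; have [fy|fy] := eqVneq (f y) +oo%E; first by rewrite fy leey.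
rewrite (fE _ fpy) (fE _ fy) lee_fin.
set fp' := fine (f p); set fy' := fine (f y).
(* comparing p with the points of the segment from p to y, to first order *)
have key t : 0 < t <= 1 ->
    fp' + 2 * q * ip (x - p) (y - p) <= fy' + t * (q * `|y - p| ^+ 2).
  move=> /andP[t0 t1].
  have t01 : 0 <= t <= 1 by rewrite ltW.
  have hfy : (f y <= fy'%:E)%E by rewrite -fE.
  have hfp : (f p <= fp'%:E)%E by rewrite -fE.
  have := pmin (t *: y + (1 - t) *: p).
  move=> /le_trans/(_ (leeD2r _ (econvex_le cf t01 hfy hfp))).
  rewrite (fE _ fpy) -/fp' -!EFinD lee_fin.
  have -> : t *: y + (1 - t) *: p - x = t *: (y - p) + (p - x).
    by rewrite scalerBr scalerBl scale1r addrA addrACA addrA.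
  rewrite -!(ipxx ip_norm).
  have -> : ip (x - p) (y - p) = - ip (p - x) (y - p).
    by rewrite -[x - p]opprB ipNl.
  rewrite !(ipDl _ _ (p - x)) !(ipDr _ _ _ (p - x)) !ipZl !ipZr.
  rewrite (ipC ip (y - p) (p - x)) => h.
  rewrite -(ler_pM2l t0).
  lra.
rewrite ipZl; apply/ler_addgt0Pr => e e0.
have K0 : 0 <= q * `|y - p| ^+ 2 by rewrite mulr_ge0 ?sqr_ge0 ?ltW.
have D0 : 0 < q * `|y - p| ^+ 2 + e + 1 by lra.
have tb : 0 < e / (q * `|y - p| ^+ 2 + e + 1) <= 1.
  by rewrite divr_gt0 //= ler_pdivrMr //; lra.
apply: (le_trans (key _ tb)); rewrite lerD2l.
rewrite mulrAC ler_pdivrMr // ler_pM2l //; lra.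
Qed.

End regularized_minimization.

(** * Proximal points, orthogonal projections and gradients *)

Section projection_and_gradient.
Context {R : realType} {H : completeNormedModType R} (ip : {dot H for idfun}).
Context (ip_norm : forall x : H, `|x| = Num.sqrt (ip x x)).
Implicit Types (f g : H -> \bar R) (V : set H) (x y v p u : H).

Lemma subdiff_fin f x u : eproper f -> subdiff ip f x u -> f x \is a fin_num.
Proof.
move=> [fN [y fy]] fu; rewrite fin_numE fN; apply/eqP => fx.
by have := fu y; rewrite fx addye // leye_eq (negPf fy).
Qed.

Lemma subdiff_monotone f x y u v : eproper f ->
  subdiff ip f x u -> subdiff ip f y v -> 0 <= ip (u - v) (x - y).
Proof.
move=> pf fu fv; have := fu y; have := fv x.
rewrite -(fineK (subdiff_fin pf fu)) -(fineK (subdiff_fin pf fv)).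
rewrite -!EFinD !lee_fin -[y - x]opprB ipNr !ipDl !ipNl; lra.
Qed.

(** A single subgradient of [f], anywhere, supplies the affine minorant under
    which the minimum defining the proximal point is attained. *)
Lemma proxP gamma f x y0 u0 : 0 < gamma -> closed_proper_convex f ->
  subdiff ip f y0 u0 ->
  let p := prox gamma f x in
  f p \is a fin_num /\ subdiff ip f p (gamma^-1 *: (x - p)).
Proof.
move=> g0 [lf pf cf] fu0.
have q0 : 0 < (2 * gamma)^-1 by rewrite invr_gt0 mulr_gt0.
have -> : gamma^-1 = 2 * (2 * gamma)^-1 by rewrite invfM mulrA divff ?mul1r.
apply: argmin_regularized_subdiff => //; apply: getPex.
apply: (argmin_regularized_ex ip_norm) => //.
have fy0 := subdiff_fin pf fu0.
exists (fine (f y0) - `|u0| * `|y0|), `|u0| => y.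
apply: le_trans (fu0 y); rewrite -[f y0]fineK // lee_fin.
rewrite ipDr ipNr; have := ip_ge ip_norm u0 y; have := ip_le ip_norm u0 y0.
by rewrite /=; lra.
Qed.

Section subspace.
Context V (V_sub : closed_subspace V).

Lemma subspace0 : V 0.
Proof. by case: V_sub => _ [h _]; have := h; rewrite inE. Qed.

Lemma subspaceDZ a x y : V x -> V y -> V (a *: x + y).
Proof. by case: V_sub => _ [_ h] /mem_set Vx /mem_set Vy; apply/set_mem/h. Qed.

Lemma subspaceD x y : V x -> V y -> V (x + y).
Proof. by move=> Vx Vy; rewrite -[x]scale1r; exact: subspaceDZ. Qed.

Lemma subspaceZ a x : V x -> V (a *: x).
Proof.
move=> Vx; rewrite -[_ *: _]addr0.
by apply: subspaceDZ => //; exact: subspace0.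
Qed.

Lemma subspaceB x y : V x -> V y -> V (x - y).
Proof.
move=> Vx Vy; apply: subspaceD => //.
by rewrite -scaleN1r; exact: subspaceZ.
Qed.

Local Notation P := (orthoproj ip V).

Lemma indic_cpc : closed_proper_convex (indic_fun (R := R) V).
Proof.
split.
- move=> x a; rewrite /indic_fun; have [xV|xV _] := boolP (x \in V).
    move=> a0; exists setT; first exact: filterT.
    by move=> y _; case: ifP => // _; rewrite ltry.
  exists (~` V).
    by apply: open_nbhs_nbhs; split; [apply: closed_openC; case: V_sub|
       move=> Vx; move/negP: xV; apply; exact: mem_set].
  by move=> y Vy; rewrite memNset // ltry.
- split=> [x|]; first by rewrite /indic_fun; case: ifP.
  by exists 0; rewrite /indic_fun mem_set //; exact: subspace0.
- move=> t x y /andP[]; rewrite le_eqVlt => /orP[/eqP<- _|t0].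
    by rewrite scale0r add0r subr0 scale1r mul0e add0e mul1e.
  rewrite le_eqVlt => /orP[/eqP->|t1].
    by rewrite subrr scale0r addr0 scale1r mul0e adde0 mul1e.
  have t1' : 0 < 1 - t by rewrite subr_gt0.
  rewrite /indic_fun; have [xV|xV] := boolP (x \in V); last first.
    rewrite gt0_muley // addye ?leey //.
    by case: (y \in V); rewrite ?mule0 // gt0_muley.
  have [yV|yV] := boolP (y \in V); last first.
    by rewrite gt0_muley // addey ?leey // mule0.
  rewrite !mule0 adde0 mem_set //.
  by apply: subspaceDZ; [|apply: subspaceZ]; apply: set_mem.
Qed.

(** The projection is the proximal point of the indicator of [V]: a subgradient
    of that indicator is nonpositive on the whole subspace, hence orthogonal to
    it. *)
Lemma orthoprojP x :
  V (P x) /\ orthocomp ip V (x - P x).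
Proof.
rewrite /orthoproj; apply: (@getPex _ [set p | V p /\ orthocomp ip V (x - p)]).
have [_ [/= fN _] _] := indic_cpc.
have sub0 : subdiff ip (indic_fun (R := R) V) 0 0.
  move=> y; rewrite ip0l adde0 /indic_fun mem_set //; last exact: subspace0.
  by case: ifP => // _; rewrite leey.
have [] := proxP x ltr01 indic_cpc sub0.
set p := prox 1 _ x; rewrite /= invr1 scale1r => fp sp.
have pV : V p.
  by move: fp; rewrite /indic_fun; case: ifP => // /set_mem.
exists p; split=> // v Vv.
have le0 w : V w -> ip (x - p) w <= 0.
  move=> Vw; have := sp (w + p); rewrite addrK /indic_fun !mem_set //.
    by rewrite add0e lee_fin.
  exact: subspaceD.
apply/eqP; rewrite eq_le le0 //=.
have := le0 (- v); rewrite ipNr oppr_le0; apply.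
by rewrite -scaleN1r; exact: subspaceZ.
Qed.

Lemma orthoproj_in x : V (P x).
Proof. by case: (orthoprojP x). Qed.

Lemma orthoproj_perp x v : V v -> ip (x - P x) v = 0.
Proof. by case: (orthoprojP x) => _; apply. Qed.

Lemma orthoproj_eq x p : V p -> orthocomp ip V (x - p) -> P x = p.
Proof.
move=> Vp op; apply/eqP; rewrite -subr_eq0; apply/eqP/(ip_eq0 ip_norm).
have Vd : V (P x - p) by apply: subspaceB => //; exact: orthoproj_in.
have : ip (P x - p) (P x - p) = 0.
  have := orthoproj_perp x Vd; have := op _ Vd.
  by rewrite !(ipDl _ _ _ (_ - _)) !ipNl; lra.
rewrite (ipxx ip_norm) => /eqP; rewrite sqrf_eq0 normr_eq0 => /eqP -> v.
by rewrite ip0l.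
Qed.

Lemma orthoproj_id x : V x -> P x = x.
Proof. by move=> Vx; apply: orthoproj_eq => // v _; rewrite subrr ip0l. Qed.

Lemma orthoproj_linear : linear P.
Proof.
move=> a x y; apply: orthoproj_eq.
  by apply: subspaceDZ; exact: orthoproj_in.
move=> v Vv; have := orthoproj_perp x Vv; have := orthoproj_perp y Vv.
rewrite !ipE => /eqP; rewrite subr_eq0 => /eqP -> /eqP.
by rewrite subr_eq0 => /eqP ->; lra.
Qed.

Lemma orthoprojZ a x : P (a *: x) = a *: P x.
Proof. by rewrite -[a *: x]addr0 orthoproj_linear (orthoproj_id subspace0) addr0. Qed.

Lemma orthoprojD x y : P (x + y) = P x + P y.
Proof. by rewrite -[x]scale1r orthoproj_linear !scale1r. Qed.

Lemma orthoprojB x y : P (x - y) = P x - P y.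
Proof. by rewrite orthoprojD -scaleN1r orthoprojZ scaleN1r. Qed.

Lemma orthoprojK x : P (P x) = P x.
Proof. by apply: orthoproj_id; exact: orthoproj_in. Qed.

Lemma orthoproj_sym x y : ip (P x) y = ip x (P y).
Proof.
have := orthoproj_perp x (orthoproj_in y).
have := orthoproj_perp y (orthoproj_in x).
rewrite !ipE (ipC ip y) (ipC ip (P y)); lra.
Qed.

Lemma norm_orthoproj_le x : `|P x| <= `|x|.
Proof.
have [->|x0] := eqVneq (P x) 0; first by rewrite normr0.
have p0 : 0 < `|P x| by rewrite normr_gt0.
rewrite -(ler_pM2l p0) -expr2 -(ipxx ip_norm).
rewrite orthoproj_sym orthoproj_id; last exact: orthoproj_in.
by rewrite ipC; apply: ip_le.
Qed.

End subspace.

(** [phi] is represented by the point that minimizes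
    [2^-1 * |y|^2 - phi y], by first-order optimality. *)
Lemma riesz (phi : {linear H -> R^o}) : continuous phi ->
  exists u, forall v, phi v = ip u v.
Proof.
move=> cphi; pose f y := (- phi y)%:E.
have q0 : 0 < 2^-1 :> R by rewrite invr_gt0.
have lf : lower_semicontinuous f.
  move=> x a; rewrite lte_fin => ax.
  exists [set y | a < - phi y]; last by move=> y /=; rewrite lte_fin.
  have cN : (fun y => - phi y) @ x --> - phi x by apply: cvgN; exact: cphi.
  exact: (cvgr_gt _ cN).
have pf : eproper f by split=> //; exists 0.
have cf : econvex f.
  move=> t x y _; rewrite /f -!EFinM -EFinD lee_fin linearD !linearZ /=.
  by rewrite /GRing.scale /=; lra.
have [p pmin] : exists p, argmin (fun y => (f y + (2^-1 * `|y - 0| ^+ 2)%:E)%E) p.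
  apply: (argmin_regularized_ex ip_norm) => //.
  have /continuous_linear_bounded/linear_boundedP[r [_ rP]] := cphi 0.
  have rr : r < `|r| + 1 by have := ler_norm r; lra.
  exists 0, (`|r| + 1) => y; rewrite lee_fin.
  have := rP _ rr y; have := ler_norm (phi y); rewrite /=; lra.
have [_] := argmin_regularized_subdiff ip_norm q0 pf cf pmin.
rewrite divff // scale1r sub0r => sp.
have le1 v : ip (- p) v <= - phi v.
  have := sp (v + p); rewrite addrK /f -EFinD lee_fin linearD /=; lra.
exists p => v; have := le1 v; have := le1 (- v).
rewrite !ipNl ipNr linearN /= => a b.
by apply/eqP; rewrite eq_le; apply/andP; split; lra.
Qed.

Lemma gradientP g x : edifferentiable g x ->
  forall v, 'd (fine \o g : H -> R^o) x v = ip (gradient ip g x) v.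
Proof.
move=> [_ dg]; rewrite /gradient.
apply: (@getPex _ [set u | forall v, 'd (fine \o g : H -> R^o) x v = ip u v]).
by apply: (@riesz ('d (fine \o g : H -> R^o) x)); exact: diff_continuous.
Qed.

Lemma gradient_eq g x u : edifferentiable g x ->
  (forall v, 'd (fine \o g : H -> R^o) x v = ip u v) -> gradient ip g x = u.
Proof.
move=> dg du; apply/eqP; rewrite -subr_eq0; apply/eqP/(ip_eq0 ip_norm) => v.
by rewrite ipDl ipNl -gradientP // du subrr.
Qed.

Lemma edifferentiable_fin g x : edifferentiable g x -> g x \is a fin_num.
Proof. by case=> /nbhs_singleton. Qed.

(** By convexity the difference quotients along a segment starting at [x] are
    at most the increment over the whole segment. *)
Lemma gradient_subdiff g x : (forall y, g y \is a fin_num) -> econvex g ->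
  edifferentiable g x -> subdiff ip g x (gradient ip g x).
Proof.
move=> gfin cg dg y.
have gE z : g z = (fine (g z))%:E by rewrite fineK.
rewrite (gE x) (gE y) lee_fin -gradientP // -lerBrDl.
have [_ dgx] := dg.
rewrite -deriveE //.
have /cvg_dnbhs_at_right cvd := diff_derivable (v := y - x) dgx.
apply: (cvgr_to_le cvd).
near=> t.
have t0 : 0 < t by near: t; exact: nbhs_right_gt.
have t1 : t <= 1 by near: t; apply: nbhs_right_le.
rewrite /= /GRing.scale /= ler_pdivrMl //.
have -> : t *: (y - x) + x = t *: y + (1 - t) *: x.
  by rewrite scalerBr scalerBl scale1r addrAC addrA.
have t01 : 0 <= t <= 1 by rewrite ltW.
have := cg t y x t01; rewrite (gE x) (gE y) gE -!EFinM -EFinD lee_fin; lra.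
Unshelve. all: by end_near. Qed.

Section gradient_comp.
Context V (V_sub : closed_subspace V).
Let P := orthoproj ip V.
Let HBP := GRing.isLinear.Build _ _ _ _ P (orthoproj_linear V_sub).
Let PL : {linear H -> H} := HB.pack P HBP.

Lemma orthoproj_continuous : continuous P.
Proof.
apply: (@linear_bounded_continuous _ _ _ PL).1.
apply/linear_boundedP; exists 1; split; first exact: num_real.
move=> r r1 x; apply: (le_trans (norm_orthoproj_le V_sub x)).
by rewrite ler_peMl // ltW.
Qed.

Lemma edifferentiable_comp_proj g x : edifferentiable g (P x) ->
  edifferentiable (g \o P) x.
Proof.
move=> [gn gd]; split; first exact: orthoproj_continuous gn.
apply: (@differentiable_comp _ _ _ _ P (fine \o g)) => //.
exact: (@linear_differentiable _ _ _ PL _ orthoproj_continuous).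
Qed.

(** Chain rule; the projection is its own adjoint. *)
Lemma gradient_comp_proj g x : edifferentiable g (P x) ->
  gradient ip (g \o P) x = P (gradient ip g (P x)).
Proof.
move=> dg; apply: gradient_eq; first exact: edifferentiable_comp_proj.
move=> v; rewrite (orthoproj_sym V_sub) -gradientP //.
have dP := @linear_differentiable _ _ _ PL x orthoproj_continuous.
have := @diff_comp _ _ _ _ PL (fine \o g : H -> R^o) x dP (proj2 dg).
rewrite diff_lin; last exact: orthoproj_continuous.
by move=> /(congr1 (@^~ v)).
Qed.
End gradient_comp.

End projection_and_gradient.

(** * Cocoercivity of Lipschitz gradients *)

Section cocoercivity.
Context {R : realType} {H : completeNormedModType R} (ip : {dot H for idfun}).
Context (ip_norm : forall x : H, `|x| = Num.sqrt (ip x x)).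
Context (h : H -> R) (G : H -> H) (L : R) (L_gt0 : 0 < L).
Context (G_sub : forall x y, h x + ip (G x) (y - x) <= h y).
Context (G_lip : forall x y, `|G x - G y| <= L * `|x - y|).

(** The constant [L] in place of [L / 2] is immediate from the subgradient
    inequality. Applying an estimate with constant [C] to both halves of the
    segment improves it to [L / 4 + C / 2], and iterating this converges to
    [L / 2]; no integration along the segment is involved. *)
Lemma descent_lemma x y :
  h y <= h x + ip (G x) (y - x) + L / 2 * `|y - x| ^+ 2.
Proof.
have step (n : nat) : forall x y,
    h y <= h x + ip (G x) (y - x) + L / 2 * (1 + (2 ^+ n)^-1) * `|y - x| ^+ 2.
  elim: n => [|n IH] {}x {}y.
    have := G_sub y x; have := ip_le ip_norm (G y - G x) (y - x).
    have := ler_wpM2r (normr_ge0 (y - x)) (G_lip y x).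
    rewrite expr0 invr1 ipDl ipNl -[x - y]opprB ipNr expr2; lra.
  pose m := 2^-1 *: (x + y).
  have mxE : m - x = 2^-1 *: (y - x).
    by apply: (ip_inj ip_norm) => v; rewrite !ipE; lra.
  have ymE : y - m = 2^-1 *: (y - x).
    by apply: (ip_inj ip_norm) => v; rewrite !ipE; lra.
  have nE : `|2^-1 *: (y - x)| = 2^-1 * `|y - x|.
    by rewrite normrZ gtr0_norm // invr_gt0.
  have := IH m y; have := IH x m; rewrite mxE ymE nE.
  have := ip_le ip_norm (G m - G x) (2^-1 *: (y - x)).
  have := ler_wpM2r (normr_ge0 (2^-1 *: (y - x))) (G_lip m x).
  rewrite mxE nE ipDl ipNl [2 ^+ n.+1]exprS invfM !ipZr.
  set c := (2 ^+ n)^-1; set d := `|y - x|; lra.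
apply/ler_addgt0Pr => e e0.
pose K := L / 2 * `|y - x| ^+ 2.
have K0 : 0 <= K by rewrite mulr_ge0 ?sqr_ge0 // divr_ge0 // ltW.
have [n] : exists n : nat, K / e < n%:R.
  exists (Num.truncn (K / e)).+1.
  exact: truncnS_gt.
move=> nK; have := step n x y.
have : K * (2 ^+ n)^-1 <= e.
  rewrite ler_pdivrMr ?exprn_gt0 // -ler_pdivrMl // mulrC.
  apply/ltW/(lt_le_trans nK); rewrite -natrX ler_nat.
  exact/ltnW/ltn_expl.
rewrite /K; lra.
Qed.

(** [half] is the sharpened subgradient inequality obtained by comparing the
    values at [a] and at the gradient step [c] from [b] for the function
    [h - ip (G a)], which [a] minimizes; adding it to its mirror image gives
    the result. *)
Lemma baillon_haddad x y : L^-1 * `|G x - G y| ^+ 2 <= ip (G x - G y) (x - y).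
Proof.
have half a b : h a + ip (G a) (b - a) + (2 * L)^-1 * `|G b - G a| ^+ 2 <= h b.
  pose c := b - L^-1 *: (G b - G a).
  have := G_sub a c; have := descent_lemma b c.
  rewrite (_ : c - b = - (L^-1 *: (G b - G a))); last first.
    by rewrite /c addrC addKr.
  rewrite (_ : c - a = b - a - L^-1 *: (G b - G a)); last by rewrite /c addrAC.
  rewrite normrN normrZ gtr0_norm ?invr_gt0 // exprMn.
  rewrite !(ipDr _ _ (b - a)) !ipNr !ipZr -(ipxx ip_norm).
  rewrite (ipDl _ _ _ (G b - G a)) ipNl.
  have -> : L / 2 * (L^-1 ^+ 2 * (ip (G b) (G b - G a) - ip (G a) (G b - G a)))
    = (2 * L)^-1 * (ip (G b) (G b - G a) - ip (G a) (G b - G a)) by field; rewrite gt_eqF.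
  have -> : L^-1 = 2 * (2 * L)^-1 by field; rewrite gt_eqF.
  lra.
have := half x y; have := half y x.
have -> : L^-1 = 2 * (2 * L)^-1 by field; rewrite gt_eqF.
rewrite -[y - x]opprB -[G y - G x]opprB normrN ipNr ipDl ipNl; lra.
Qed.

End cocoercivity.

(** * Averaged operators and their relaxed iteration *)

Section averaged.
Context {R : realType} {H : completeNormedModType R} (ip : {dot H for idfun}).
Context (ip_norm : forall x : H, `|x| = Num.sqrt (ip x x)).

(** With [c = (1 - alpha) / alpha] these are the [alpha]-averaged operators. The
    constant [c] is used because it enters all estimates linearly. *)
Definition averaged (c : R) (T : H -> H) := forall x y,
  `|T x - T y| ^+ 2 <= `|x - y| ^+ 2 - c * `|(x - T x) - (y - T y)| ^+ 2.

(** With [d = x - y], [t = T x - T y] and [k = G x - G y], the firm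
    nonexpansiveness of [S] gives [|t|^2 <= ip t (d - gamma *: k)].
    Cocoercivity bounds [ip k t] below by [b |k|^2 - ip k (d - t)], which is at
    least [- |d - t|^2 / (4 * b)] by completing the square. *)
Lemma averaged_comp (S T G : H -> H) (gamma b : R) : 0 < gamma -> 0 < b ->
  (forall x y, `|S x - S y| ^+ 2 <= ip (S x - S y) (x - y)) ->
  (forall x y, b * `|G x - G y| ^+ 2 <= ip (G x - G y) (x - y)) ->
  (forall x, T x = S (x - gamma *: G x)) ->
  averaged (1 - gamma / (2 * b)) T.
Proof.
move=> g0 b0 Sf Gc TE x y.
have := Sf (x - gamma *: G x) (y - gamma *: G y); rewrite -!TE.
have -> : x - gamma *: G x - (y - gamma *: G y) = (x - y) - gamma *: (G x - G y).
  by apply: (ip_inj ip_norm) => v; rewrite !ipE; lra.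
have -> : x - T x - (y - T y) = (x - y) - (T x - T y).
  by apply: (ip_inj ip_norm) => v; rewrite !ipE; lra.
have := Gc x y.
move: (x - y) (T x - T y) (G x - G y) => d t k.
have := ip_ge0 ip ((2 * b) *: k - (d - t)).
rewrite -!(ipxx ip_norm) !ipE (ipC ip t d) (ipC ip t k) (ipC ip d k) => sq hG hS.
have : gamma / (2 * b) * (2 * b) = gamma by rewrite divfK; lra.
have : 0 < gamma / (2 * b) by rewrite divr_gt0 ?mulr_gt0.
move: (gamma / _) => r r0 rE; move: g0 hS; rewrite -{}rE => g0 hS.
have := ler_wpM2l (ltW g0) hG; have := mulr_ge0 (ltW r0) sq.
lra.
Qed.

Lemma fejer c (T : H -> H) lambda x y : averaged c T -> T y = y -> 0 <= lambda ->
  `|relax lambda T x - y| ^+ 2 <=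
    `|x - y| ^+ 2 - lambda * (1 + c - lambda) * `|T x - x| ^+ 2.
Proof.
move=> aT Ty l0; have := aT x y; rewrite Ty subrr subr0.
have -> : relax lambda T x - y = (x - y) + lambda *: (T x - x).
  by apply: (ip_inj ip_norm) => v; rewrite /relax !ipE; lra.
have -> : T x - y = (x - y) + (T x - x).
  by apply: (ip_inj ip_norm) => v; rewrite !ipE; lra.
rewrite -[x - T x]opprB normrN.
move: (x - y) (T x - x) => d r; rewrite -!(ipxx ip_norm) !ipE (ipC ip r d) => hh.
have := ler_wpM2l l0 hh; lra.
Qed.

(** Between two consecutive iterates the displacement is [lambda] times the
    residual [r]. The averagedness inequality then gives, for the next residual
    [r'], that [lambda (|r'|^2 - |r|^2)] is at most
    [(lambda - (1 + c)) |r' - r|^2]. *)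
Lemma residual_nonincreasing c (T : H -> H) lambda x :
  averaged c T -> 0 < lambda < 1 + c ->
  `|T (relax lambda T x) - relax lambda T x| <= `|T x - x|.
Proof.
move=> aT /andP[l0 lc].
have := aT (relax lambda T x) x; set x' := relax lambda T x.
have x'E : x' = x + lambda *: (T x - x).
  by apply: (ip_inj ip_norm) => v; rewrite /x' /relax !ipE; lra.
have -> : T x' - T x = (T x' - x') - (T x - x) + (x' - x).
  by apply: (ip_inj ip_norm) => v; rewrite !ipE; lra.
have -> : x' - x = lambda *: (T x - x) by rewrite x'E addrC addKr.
have -> : x' - T x' - (x - T x) = (T x - x) - (T x' - x').
  by apply: (ip_inj ip_norm) => v; rewrite !ipE; lra.
move: (T x' - x') (T x - x) => r' r hh.
rewrite -(@ler_pXn2r _ 2) ?nnegrE //; move: hh.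
have := ip_ge0 ip (r' - r).
rewrite -!(ipxx ip_norm) !ipE (ipC ip r' r) => s hh.
rewrite -(ler_pM2l l0).
have : 0 <= (1 + c - lambda) * (ip r' r' + - ip r r' + - (ip r r' + - ip r r)).
  by rewrite mulr_ge0 // subr_ge0 ltW.
lra.
Qed.

End averaged.

(** * Rates for nonincreasing sequences with summable squares *)

Section rates.
Context {R : realType}.
Implicit Types (a s : nat -> R) (tau : R).

(** As [s] is nonincreasing, each of the [n] decrements is at least the one
    that its last value would give. *)
Lemma decrease_by_last_term a s tau : 0 <= tau -> (forall k, 0 <= s k) ->
  (forall k, s k.+1 <= s k) ->
  (forall k, a k.+1 <= a k - tau * s k ^+ 2) ->
  forall m n, a (m + n)%N <= a m - tau * (n%:R * s (m + n)%N ^+ 2).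
Proof.
move=> t0 s0 sS aS m; elim=> [|n IH]; first by rewrite addn0 mul0r mulr0 subr0.
rewrite addnS; have := ler_pXn2r (n := 2) isT (s0 (m + n).+1) (s0 (m + n)%N).
rewrite sS => h; apply: (le_trans (aS _)).
have h1 := ler_wpM2l t0 h.
have h2 := ler_wpM2l (ler0n R n) h1.
rewrite -natr1; lra.
Qed.

Lemma fejer_rate a s tau : 0 < tau ->
  (forall k, 0 <= s k) -> (forall k, 0 <= a k) ->
  (forall k, s k.+1 <= s k) ->
  (forall k, a k.+1 ^+ 2 <= a k ^+ 2 - tau * s k ^+ 2) ->
  forall k, s k <= a 0%N / Num.sqrt (tau * k.+1%:R).
Proof.
move=> t0 s0 a0 sS aS k.
have q0 : 0 < tau * k.+1%:R by rewrite mulr_gt0.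
rewrite ler_pdivlMr ?sqrtr_gt0 //.
rewrite -(@ler_pXn2r _ 2) ?nnegrE ?mulr_ge0 ?sqrtr_ge0 //.
rewrite exprMn sqr_sqrtr; last exact: ltW.
have := decrease_by_last_term (a := fun k => a k ^+ 2) (ltW t0) s0 sS aS 0 k.
have := aS k; have := sqr_ge0 (a k.+1).
rewrite /= add0n -natr1; lra.
Qed.

(** If [a m] is close to the infimum of [a], the sum from index [m] on of the
    squares of [s] is small, and for [k >= 2 * m] more than half of the indices
    up to [k] are at least [m]. *)
Lemma summable_littleo a s tau : 0 < tau ->
  (forall k, 0 <= s k) -> (forall k, 0 <= a k) ->
  (forall k, s k.+1 <= s k) ->
  (forall k, a k.+1 <= a k - tau * s k ^+ 2) ->
  s =o_\oo (fun k => (Num.sqrt k.+1%:R)^-1 : R).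
Proof.
move=> t0 s0 a0 sS aS; apply/eqoP => e e0.
have ra : has_inf (range a).
  by split; [exists (a 0%N), 0%N|exists 0 => _ [k _ <-]].
have d0 : 0 < tau * e ^+ 2 / 2 by rewrite divr_gt0 ?mulr_gt0 ?exprn_gt0.
have [_ [m _ <-] am] := inf_adherent d0 ra.
exists (2 * m)%N => // k /= mk.
have q0 : 0 < k.+1%:R :> R by [].
rewrite ger0_norm // [`|_^-1|]ger0_norm ?invr_ge0 ?sqrtr_ge0 //.
rewrite ler_pdivlMr ?sqrtr_gt0 //.
rewrite -(@ler_pXn2r _ 2) ?nnegrE ?mulr_ge0 ?sqrtr_ge0 ?(ltW e0) //.
rewrite exprMn sqr_sqrtr; last exact: ltW.
have mk' : (m <= k)%N by apply: leq_trans mk; rewrite leq_pmull.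
have := decrease_by_last_term (ltW t0) s0 sS aS m (k - m); rewrite subnKC //.
have inf_le : inf (range a) <= a k.+1 by apply: ge_inf; [case: ra|exists k.+1].
have := aS k; rewrite natrB // => h1 h2.
have mkR : 2 * m%:R <= k%:R :> R by rewrite -natrM ler_nat.
have h3 : tau * ((k%:R - m%:R + 1) * s k ^+ 2) <= tau * e ^+ 2 / 2 by lra.
have h4 : (k.+1%:R / 2) * (tau * s k ^+ 2) <=
    (k%:R - m%:R + 1) * (tau * s k ^+ 2).
  apply: ler_wpM2r; first by rewrite mulr_ge0 ?sqr_ge0 ?ltW.
  by rewrite -natr1; lra.
rewrite -(ler_pM2l t0); lra.
Qed.

Lemma dominated_littleo (u s e : nat -> R) C :
  (forall k, `|u k| <= C * s k) -> s =o_\oo e -> u =o_\oo e.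
Proof.
move=> us /eqoP so; apply/eqoP => d d0.
have c0 : 0 < d / (`|C| + 1) by rewrite divr_gt0 // ltr_pwDr.
have := so _ c0; apply: filterS => k hk.
apply: (le_trans (us k)).
have h1 : C * s k <= (`|C| + 1) * `|s k|.
  apply: (le_trans (ler_norm _)); rewrite normrM ler_wpM2r //; lra.
apply: (le_trans h1); rewrite -ler_pdivlMl; last by rewrite ltr_pwDr.
by apply: (le_trans hk); rewrite mulrA [_^-1 * d]mulrC.
Qed.

End rates.

(** * The FDRS operator and its objective gap *)

Section fdrs_theory.
Context {R : realType} {H : completeNormedModType R} (ip : {dot H for idfun}).
Context (ip_norm : forall x : H, `|x| = Num.sqrt (ip x x)).
Context (V : set H) (V_sub : closed_subspace V) (f g : H -> \bar R).
Context (f_cpc : closed_proper_convex f) (g_cpc : closed_proper_convex g).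
Context (g_diff : forall x, edifferentiable g x).
Context (betaV gamma : R) (betaV_gt0 : 0 < betaV) (gamma_gt0 : 0 < gamma).
Context (gradh_lip : betaV^-1.-lipschitz (gradient ip (g \o orthoproj ip V))).
(* some subgradient of [f], which makes its proximal points well defined *)
Context (y0 u0 : H) (f_sub0 : subdiff ip f y0 u0).

Local Notation P := (orthoproj ip V).
Local Notation h := (g \o P).
Local Notation G := (gradient ip h).
Local Notation T := (fdrs ip gamma f g V).
Local Notation forward z := (z - gamma *: G z).
Local Notation xf z := (prox gamma f (refl P (forward z))).

Lemma gradhE x : G x = P (gradient ip g (P x)).
Proof. exact: gradient_comp_proj. Qed.

Lemma gradh_in x : P (G x) = G x.
Proof. by rewrite gradhE orthoprojK. Qed.

Lemma gradh_proj x : G (P x) = G x.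
Proof. by rewrite !gradhE orthoprojK. Qed.

Lemma h_fin x : h x \is a fin_num.
Proof. exact: (edifferentiable_fin (g_diff (P x))). Qed.

Lemma gradh_le x y : fine (h x) + ip (G x) (y - x) <= fine (h y).
Proof.
have hcv : econvex h.
  move=> t a b t01; rewrite /= orthoprojD // !orthoprojZ //.
  by have [_ _] := g_cpc; apply.
have hd := edifferentiable_comp_proj ip_norm V_sub (g_diff (P x)).
have := gradient_subdiff ip_norm h_fin hcv hd y.
by rewrite -(fineK (h_fin x)) -(fineK (h_fin y)) -EFinD lee_fin.
Qed.

Lemma gradh_lipschitz x y : `|G x - G y| <= betaV^-1 * `|x - y|.
Proof. exact: (gradh_lip (conj Logic.I Logic.I : (setT `*` setT) (x, y))). Qed.

Lemma gradh_cocoercive x y :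
  betaV * `|G x - G y| ^+ 2 <= ip (G x - G y) (x - y).
Proof.
have b0 : 0 < betaV^-1 by rewrite invr_gt0.
by have := baillon_haddad ip_norm b0 gradh_le gradh_lipschitz x y; rewrite invrK.
Qed.

Lemma prox_sub x :
  subdiff ip f (prox gamma f x) (gamma^-1 *: (x - prox gamma f x)).
Proof. by have [] := proxP ip_norm x gamma_gt0 f_cpc f_sub0. Qed.

Lemma prox_fin x : f (prox gamma f x) \is a fin_num.
Proof. by have [] := proxP ip_norm x gamma_gt0 f_cpc f_sub0. Qed.

Let S w := 2^-1 *: w + 2^-1 *: (refl (prox gamma f) \o refl P) w.

Lemma reflectionsE w : S w = prox gamma f (refl P w) + (w - P w).
Proof.
rewrite /S /= /refl; apply: (ip_inj ip_norm) => v; rewrite !ipE; lra.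
Qed.

(** With [p] and [p'] the two proximal points, the inner product of [S x - S y]
    with [(x - y) - (S x - S y)] is [gamma] times that of [p - p'] with the
    difference of the subgradients of [f] at [p] and [p'], up to terms that pair
    a vector of [V] with one orthogonal to [V]. *)
Lemma reflections_firmly_nonexpansive x y :
  `|S x - S y| ^+ 2 <= ip (S x - S y) (x - y).
Proof.
have [_ pf _] := f_cpc.
have := subdiff_monotone pf (prox_sub (refl P x)) (prox_sub (refl P y)).
rewrite -scalerBr ipZl pmulr_rge0 ?invr_gt0 // !reflectionsE.
set p := prox _ _ _; set p' := prox _ _ _ => mono.
have PdP := orthoproj_perp ip_norm V_sub (x - y)
  (orthoproj_in ip_norm V_sub (x - y)).
move: mono PdP; rewrite /refl orthoprojB // -(ipxx ip_norm).
have -> : 2 *: P x - x - p - (2 *: P y - y - p') =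
    2 *: (P x - P y) - (x - y) - (p - p').
  by apply: (ip_inj ip_norm) => v; rewrite !ipE; lra.
have -> : p + (x - P x) - (p' + (y - P y)) = (p - p') + ((x - y) - (P x - P y)).
  by apply: (ip_inj ip_norm) => v; rewrite !ipE; lra.
move: (x - y) (P x - P y) (p - p') => d Pd dp.
rewrite !ipE (ipC ip Pd d) (ipC ip dp d) (ipC ip dp Pd); lra.
Qed.

Lemma fdrs_averaged : averaged (1 - gamma / (2 * betaV)) T.
Proof.
exact: (averaged_comp ip_norm gamma_gt0 betaV_gt0
  reflections_firmly_nonexpansive gradh_cocoercive).
Qed.

(** The component of the forward point orthogonal to [V] is that of [z], as [G]
    takes its values in [V]. *)
Lemma fdrs_residual z : T z - z = xf z - P z.
Proof.
have -> : T z = S (forward z) by [].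
rewrite reflectionsE orthoprojB // orthoprojZ // gradh_in.
by apply: (ip_inj ip_norm) => v; rewrite !ipE; lra.
Qed.

Section gap.
Context (z xs : H) (Vxs : V xs) (u : H) (f_sub : subdiff ip f xs u).
Let gap := fine (f (xf z)) + fine (h (P z)) - fine (f xs) - fine (h xs).

Lemma gap_lower_bound : orthocomp ip V (- u - G xs) ->
  - (`|u| * `|xf z - P z|) <= gap.
Proof.
move=> uG; have [_ pf _] := f_cpc.
have := f_sub (xf z).
rewrite -(fineK (prox_fin _)) -(fineK (subdiff_fin pf f_sub)).
rewrite -EFinD lee_fin => h1.
have h2 := gradh_le xs (P z).
have h3 := uG _ (subspaceB V_sub (orthoproj_in ip_norm V_sub z) Vxs).
have := ip_ge ip_norm u (xf z - P z).
move: h1 h2 h3; rewrite /gap !ipE.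
lra.
Qed.

(** [main] adds the subgradient inequality of [f] at [xf z], with the subgradient
    given by the proximal step, to that of [h] at [P z]. After orthogonality
    only inner products with the residual [D] remain, and [- |D|^2] is
    dropped. *)
Lemma gap_upper_bound zs : xs = P zs ->
  gap <= gamma^-1 * (`|zs - xs| + (1 + gamma / betaV) * `|z - zs|
           + gamma * `|G xs|) * `|xf z - P z|.
Proof.
move=> xsE; have [_ pf _] := f_cpc.
have := prox_sub (refl P (forward z)) xs; set p := xf z.
rewrite -(fineK (prox_fin _)) -(fineK (subdiff_fin pf f_sub)).
rewrite -EFinD lee_fin -/p => h1.
have h2 := gradh_le (P z) xs.
have perp := orthoproj_perp ip_norm V_sub z
   (subspaceB V_sub (orthoproj_in ip_norm V_sub z) Vxs).
have yE : refl P (forward z) - p = (P z - p) + (P z - z) - gamma *: G z.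
  rewrite /refl orthoprojB // orthoprojZ // gradh_in.
  by apply: (ip_inj ip_norm) => v; rewrite !ipE; lra.
have Gs : G xs = G zs by rewrite xsE gradh_proj.
pose D := p - P z; pose w := z - P z; pose e := P z - xs.
have main : gamma * gap <= - ip D (D + w + e + gamma *: G z).
  have -> : gamma * gap = gamma * (fine (f p) - fine (f xs)) +
      gamma * (fine (h (P z)) - fine (h xs)) by rewrite /gap -/p; lra.
  move: h1 h2 perp; rewrite -/w -/e gradh_proj yE.
  have -> : xs - p = - (D + e).
    by apply: (ip_inj ip_norm) => v; rewrite !ipE; lra.
  have -> : xs - P z = - e by rewrite opprB.
  have -> : P z - p + (P z - z) - gamma *: G z = - (D + w + gamma *: G z).
    by apply: (ip_inj ip_norm) => v; rewrite !ipE; lra.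
  move: D w e (G z) => D w e k h1 h2 perp.
  have h1' : gamma * (fine (f p) - fine (f xs)) <=
      - ip (D + w + gamma *: k) (D + e).
    rewrite -ler_pdivlMl //; move: h1; rewrite ipZl ipNl ipNr; lra.
  have h2' : gamma * (fine (h (P z)) - fine (h xs)) <= gamma * ip k e.
    by rewrite ler_pM2l //; move: h2; rewrite ipNr; lra.
  move: h1' h2' perp; rewrite !ipE (ipC ip w D) (ipC ip k D); lra.
have tri : `|w + e + gamma *: G z| <=
    `|zs - xs| + (1 + gamma / betaV) * `|z - zs| + gamma * `|G xs|.
  have -> : w + e + gamma *: G z =
      (zs - xs) + (z - zs) + gamma *: (G z - G zs) + gamma *: G xs.
    rewrite Gs /w /e; move: (G z) (G zs) (P z) => k ks a.
    by apply: (ip_inj ip_norm) => v; rewrite !ipE; lra.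
  apply: (le_trans (ler_normD _ _)); rewrite normrZ gtr0_norm // lerD2r.
  apply: (le_trans (ler_normD _ _)); rewrite normrZ gtr0_norm //.
  have := ler_normD (zs - xs) (z - zs).
  have := ler_wpM2l (ltW gamma_gt0) (gradh_lipschitz z zs); lra.
rewrite -mulrA ler_pdivlMl //; apply: (le_trans main).
rewrite -/D -!(addrA D) ipDr (ipxx ip_norm) opprD.
have := sqr_ge0 `|D|; have := ip_ge ip_norm D (w + e + gamma *: G z).
have := ler_wpM2r (normr_ge0 D) tri; rewrite addrA; lra.
Qed.

End gap.
End fdrs_theory.

(** * Convergence rates of the FDRS iteration *)

Theorem theorem3p4 (R : realType) (H : completeNormedModType R)
  (ip : {dot H for idfun}) (ip_norm : forall x : H, `|x| = Num.sqrt (ip x x))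
  (V : set H) (V_sub : closed_subspace V)
  (f g : H -> \bar R)
  (f_cpc : closed_proper_convex f) (g_cpc : closed_proper_convex g)
  (g_diff : forall x, edifferentiable g x)
  (beta : R) (beta_gt0 : 0 < beta)
  (gradg_lip : beta^-1.-lipschitz (gradient ip g))
  (betaV : R) (betaV_gt0 : 0 < betaV)
  (gradh_lip : betaV^-1.-lipschitz (gradient ip (g \o orthoproj ip V)))
  (ex_sol : exists x u v : H, [/\ subdiff ip f x u,
     subdiff ip (indic_fun V) x v & 0 = u + gradient ip g x + v])
  (gamma : R) (gamma_bnd : 0 < gamma < 2 * betaV)
  (lambda : nat -> R) (z : nat -> H) (zs gradf : H) :
  let h := g \o orthoproj ip V in
  let alpha := 2 * betaV / (4 * betaV - gamma) in
  let tau := inf (range (fun j => (1 - alpha * lambda j) * lambda j / alpha)) in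
  let T := fdrs ip gamma f g V in
  let xs := orthoproj ip V zs in
  let xh k := orthoproj ip V (z k) in
  let xf k :=
    prox gamma f (refl (orthoproj ip V) (z k - gamma *: gradient ip h (z k))) in
  let gap k := (f (xf k) + h (xh k) - f xs - g xs)%E in
  (forall k, 0 < lambda k < alpha^-1) ->
  0 < tau ->
  (forall k, z k.+1 = relax (lambda k) T (z k)) ->
  T zs = zs ->
  subdiff ip f xs gradf ->
  orthocomp ip V (- gradf - gradient ip h xs) ->
  [/\ forall k, `|xf k - xh k| <= `|z 0%N - zs| / Num.sqrt (tau * k.+1%:R),
      (fun k => `|xf k - xh k|) =o_\oo (fun k => (Num.sqrt k.+1%:R)^-1 : R),
      forall k,
        ((- (`|z 0%N - zs| * `|gradf| / Num.sqrt (tau * k.+1%:R)))%:E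
           <= gap k)%E /\
        (gap k <= ((`|zs - xs| + (1 + gamma / betaV) * `|z 0%N - zs|
                      + gamma * `|gradient ip h xs|) * `|z 0%N - zs|
                   / (gamma * Num.sqrt (tau * k.+1%:R)))%:E)%E
    & (fun k => `|fine (gap k)|) =o_\oo (fun k => (Num.sqrt k.+1%:R)^-1 : R)].
Proof.
move=> h alpha tau T xs xh xf gap lam tau0 zS Tzs f_xs orth.
have [g0 g2] : 0 < gamma /\ gamma < 2 * betaV by apply/andP.
pose c := 1 - gamma / (2 * betaV).
have aT : averaged c T.
  exact: (fdrs_averaged ip_norm V_sub f_cpc g_cpc g_diff betaV_gt0 g0 gradh_lip
    f_xs).
have alphaE : alpha^-1 = 1 + c.
  by rewrite /alpha /c; field; apply/andP; split; rewrite gt_eqF //; lra.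
have alpha0 : 0 < alpha by rewrite divr_gt0 //; lra.
have stepE k : (1 - alpha * lambda k) * lambda k / alpha =
    lambda k * (1 + c - lambda k).
  by rewrite -alphaE; field; rewrite gt_eqF.
have tau_le k : tau <= lambda k * (1 + c - lambda k).
  rewrite -stepE; apply: ge_inf; last by exists k.
  exists 0 => _ [j _ <-]; rewrite stepE; have /andP[l0] := lam j.
  by rewrite alphaE => l1; rewrite mulr_ge0 ?subr_ge0 // ltW.
pose s k := `|xf k - xh k|; pose d k := `|z k - zs|.
have sE k : s k = `|T (z k) - z k|.
  by rewrite /s (fdrs_residual ip_norm V_sub f g_diff gamma (z k)).
have s_ge0 k : 0 <= s k by exact: normr_ge0.
have d_ge0 k : 0 <= d k by exact: normr_ge0.
have s_ni k : s k.+1 <= s k.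
  rewrite !sE zS; apply: (residual_nonincreasing ip_norm (z k) aT).
  by rewrite -alphaE.
have d_step k : d k.+1 ^+ 2 <= d k ^+ 2 - tau * s k ^+ 2.
  have /andP[/ltW l0 _] := lam k.
  rewrite /d zS sE; apply: (le_trans (fejer ip_norm (z k) aT Tzs l0)).
  by rewrite lerD2l lerN2 ler_wpM2r ?sqr_ge0.
have d_le k : d k <= d 0%N.
  elim: k => // k; apply: le_trans.
  rewrite -(@ler_pXn2r _ 2) ?nnegrE //; apply: (le_trans (d_step k)).
  by rewrite gerDl oppr_le0 mulr_ge0 ?sqr_ge0 ?ltW.
have rate := fejer_rate tau0 s_ge0 d_ge0 s_ni d_step.
have so := summable_littleo tau0 s_ge0 (fun k => sqr_ge0 (d k)) s_ni d_step.
have Vxs : V xs by exact: orthoproj_in.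
have Pxs : orthoproj ip V xs = xs by exact: orthoproj_id.
have [_ pf _] := f_cpc.
have gapE k : gap k =
    (fine (f (xf k)) + fine (h (xh k)) - fine (f xs) - fine (h xs))%:E.
  rewrite /gap -(fineK (prox_fin ip_norm f_cpc g0 f_xs _)).
  have hf : h (xh k) \is a fin_num by exact: h_fin.
  rewrite -(fineK hf).
  rewrite -[f xs]fineK ?(subdiff_fin pf f_xs) //.
  rewrite -[g xs]fineK; last exact: edifferentiable_fin.
  by rewrite !EFinB EFinD /h /= Pxs.
have lower k : - (`|gradf| * s k) <= fine (gap k).
  by rewrite gapE; exact: gap_lower_bound.
pose C := gamma^-1 * (`|zs - xs| + (1 + gamma / betaV) * d 0%N
  + gamma * `|gradient ip h xs|).
have gb0 : 0 < gamma / betaV by rewrite divr_gt0.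
have C0 : 0 <= C.
  rewrite mulr_ge0 ?invr_ge0 ?(ltW g0) // addr_ge0 ?mulr_ge0 ?(ltW g0) //.
  by rewrite addr_ge0 // mulr_ge0 //; lra.
have upper k : fine (gap k) <= C * s k.
  rewrite gapE /=.
  have := gap_upper_bound ip_norm V_sub f_cpc g_cpc g_diff g0 gradh_lip f_xs
    (z k) Vxs f_xs (erefl xs).
  move=> /le_trans; apply; apply: ler_wpM2r; first exact: s_ge0.
  rewrite ler_pM2l ?invr_gt0 // lerD2r lerD2l ler_pM2l; last lra.
  exact: d_le.
split => //.
- move=> k; have gfin : gap k = (fine (gap k))%:E by rewrite gapE.
  rewrite gfin !lee_fin; split.
    apply: le_trans (lower k); rewrite lerN2 mulrAC mulrC.
    by apply: ler_wpM2r; [exact: normr_ge0|exact: rate].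
  apply: (le_trans (upper k)); apply: (le_trans (ler_wpM2l C0 (rate k))).
  by rewrite /C invfM /d le_eqVlt; apply/orP; left; apply/eqP; ring.
- apply: (dominated_littleo (s := s) (C := `|gradf| + C)) => // k.
  rewrite normr_id ler_norml mulrDl.
  have := lower k; have := upper k.
  have : 0 <= `|gradf| * s k by rewrite mulr_ge0.
  have : 0 <= C * s k by rewrite mulr_ge0.
  by move=> *; apply/andP; split; lra.
Qed.
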